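(* For each $n\in\mathbb{N}$ such that $n\geqslant 2$, there is a finite non-commutative completely $0$-simple semigroup whose commuting graph has diameter equal to $n$.
   Context: A semigroup $S$ with a zero $0$ is completely $0$-simple if it is $0$-simple (it is not a null semigroup and its only ideals are $\{0\}$ and $S$) and it contains a primitive idempotent (an idempotent that is minimal among the non-zero idempotents, in the natural partial order of idempotents). The commuting graph of a finite non-commutative semigroup $S$ is the simple graph with vertex set $S\setminus Z(S)$, where $Z(S)$ is the center of $S$, and where distinct vertices $x,y$ are adjacent iff $xy=yx$. The diameter is the maximum distance between vertices (infinite if the graph is not connected). *)

(* Defs.v *)
From HB Require Import structures.
From mathcomp Require Import all_boot.

Set Implicit Arguments.
Unset Strict Implicit.
Unset Printing Implicit Defensive.

Local Open Scope group_scope.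

#[short(type="finSemigroupType")]
HB.structure Definition FinSemigroup := {S of Semigroup S & Finite S}.

Section Semigroup.

Variable S : finSemigroupType.
Implicit Types (x y z e f : S) (I : {set S}).

Definition noncommutative : Prop := exists x y, x * y <> y * x.

Definition center : {set S} := [set x | [forall y, x * y == y * x]].

Definition is_zero z : Prop := forall x, z * x = z /\ x * z = z.

(* Ideals are non-empty, as usual in semigroup theory; otherwise set0 would
   be an ideal besides [set z] and setT and no semigroup would be 0-simple. *)
Definition ideal I : Prop :=
  I != set0 /\ forall s x, x \in I -> s * x \in I /\ x * s \in I.

Definition null_semigroup z : Prop := forall x y, x * y = z.

Definition zero_simple z : Prop :=
  ~ null_semigroup z /\ forall I, ideal I <-> I = [set z] \/ I = [set: S].

Definition idempotent_elt e : Prop := e * e = e.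

(* The natural partial order, meant for idempotents e and f. *)
Definition idempotent_le e f : Prop := e * f = e /\ f * e = e.

Definition primitive_idempotent z e : Prop :=
  [/\ idempotent_elt e, e <> z
    & forall f, idempotent_elt f -> f <> z -> idempotent_le f e -> f = e].

Definition completely_zero_simple : Prop :=
  exists z, [/\ is_zero z, zero_simple z & exists e, primitive_idempotent z e].

Definition commuting_graph : rel {x : S | x \notin center} :=
  fun u v => (u != v) && (val u * val v == val v * val u).

End Semigroup.

Arguments noncommutative : clear implicits.
Arguments center : clear implicits.
Arguments completely_zero_simple : clear implicits.
Arguments commuting_graph : clear implicits.

Section Diameter.

Variables (V : finType) (adj : rel V).

(* x :: p is a walk, whose number of edges is size p. *)
Definition is_distance (x y : V) (d : nat) : Prop :=
  (exists p, [/\ path adj x p, last x p = y & size p = d]) /\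
  (forall p, path adj x p -> last x p = y -> d <= size p).

(* A graph that is not connected has infinite diameter, hence has_diameter n
   for no n. *)
Definition has_diameter (n : nat) : Prop :=
  [/\ forall x y, connect adj x y,
      exists x y, is_distance x y n
    & forall x y d, is_distance x y d -> d <= n].

End Diameter.

(* Main.v *)
Require Import Defs.
From HB Require Import structures.
From mathcomp Require Import all_boot.
From mathcomp Require Import zify.

Set Implicit Arguments.
Unset Strict Implicit.
Unset Printing Implicit Defensive.

(** The semigroup is a Rees 0-matrix semigroup over the trivial group whose
    rows and columns are indexed by Z/(n+1).  Two distinct nonzero elements
    (i, l) and (j, m) commute iff the entries (l, j) and (m, i) of the sandwich
    matrix both vanish.  A walk in the commuting graph is therefore a pair of
    walks of the same length in the bipartite graph of zero entries, and we
    choose the matrix so that this bipartite graph is a cycle of length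
    2(n+1).  In this cycle, walks of length n from a given vertex reach all
    n+1 vertices of the appropriate side, and some vertices of either side are
    at distance at least n from a given one. *)

Definition rees (I L : finType) (P : L -> I -> bool) : Type := option (I * L).

(** * Rees 0-matrix semigroups and their commuting graphs *)

Section Rees.

Variables (I L : finType) (P : L -> I -> bool).

HB.instance Definition _ := Finite.copy (rees P) (option (I * L)).

Definition rees_mul (x y : rees P) : rees P :=
  match x, y with
  | Some (i, l), Some (j, m) => if P l j then Some (i, m) else None
  | _, _ => None
  end.

Lemma rees_mulA : associative rees_mul.
Proof.
case=> [[i l]|] [[j m]|] [[k o]|] //=; [|by case: ifP..].
by case Plj: (P l j); case Pmk: (P m k) => /=; rewrite ?Plj ?Pmk.
Qed.

HB.instance Definition _ := hasMul.Build (rees P) rees_mul.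
HB.instance Definition _ := Magma_isSemigroup.Build (rees P) rees_mulA.

Local Open Scope group_scope.

(** [Some], typed so that products are read in [rees P]. *)
Definition rees_elt (x : I * L) : rees P := Some x.

Lemma mul_rees_elt i l j m :
  rees_elt (i, l) * rees_elt (j, m) =
    if P l j then rees_elt (i, m) else None.
Proof. by []. Qed.

Lemma rees_commute i l j m :
  (rees_elt (i, l) * rees_elt (j, m) == rees_elt (j, m) * rees_elt (i, l)) =
    ((i, l) == (j, m)) || ~~ P l j && ~~ P m i.
Proof.
rewrite !mul_rees_elt.
have [[-> ->]|neq] := eqVneq (i, l) (j, m); first by rewrite eqxx.
case: (P l j); case: (P m i) => //=.
by apply: contra_neqF neq => /eqP [-> ->].
Qed.

Lemma rees_is_zero : is_zero (None : rees P).
Proof. by case=> [[]|]. Qed.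

Hypothesis row_neq0 : forall l, exists i, P l i.
Hypothesis col_neq0 : forall i, exists l, P l i.

Lemma rees_completely_zero_simple :
  #|I| != 0 -> completely_zero_simple (rees P).
Proof.
case: (pickP I) => [i0 _ _|noI]; last by rewrite (eq_card0 noI).
have [l0 Pl0] := col_neq0 i0.
have e0E : rees_elt (i0, l0) * rees_elt (i0, l0) = rees_elt (i0, l0).
  by rewrite mul_rees_elt Pl0.
exists None; split; first exact: rees_is_zero.
  split=> [null|A].
    by have := null (rees_elt (i0, l0)) (rees_elt (i0, l0)); rewrite e0E.
  split=> [[/set0Pn[a Aa] idA]|[->|->]].
  - have A0 : None \in A.
      by have [] := idA None a Aa; rewrite (rees_is_zero a).1.
    case: (pickP [pred x : I * L | rees_elt x \in A]) => [[i l] /= Ail|noA].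
      right; apply/setP=> -[[j m]|]; rewrite !inE //.
      have [[l' Pl'] [i' Pi']] := (col_neq0 i, row_neq0 l).
      (* [(j, l') (i, l) (i', m) = (j, m)], so one non-zero element generates all. *)
      have [_ /(idA (rees_elt (j, l')))[+ _]] := idA (rees_elt (i', m)) _ Ail.
      by rewrite mul_rees_elt Pi' mul_rees_elt Pl'.
    left; apply/setP=> -[x|]; rewrite !inE ?A0 ?eqxx //; exact: noA.
  - split; first by apply/set0Pn; exists None; rewrite inE.
    move=> s x /set1P ->.
    by rewrite !inE (rees_is_zero s).1 (rees_is_zero s).2 eqxx.
  - split=> [|s x _]; last by rewrite !inE.
    by apply/set0Pn; exists None; rewrite inE.
exists (rees_elt (i0, l0)); split=> // -[[j m]|] // _ _ [].
rewrite -/(rees_elt (j, m)) !mul_rees_elt.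
by case: ifP => // _ [->]; case: ifP => // _ [->].
Qed.

Hypothesis L_gt1 : 1 < #|L|.

(** Distinct elements commute only if both products vanish, which a choice of [j] with [P l j]
    prevents. *)
Lemma rees_elt_noncentral x : rees_elt x \notin center (rees P).
Proof.
case: x => i l; have [j Plj] := row_neq0 l.
have [m neq_ml] : exists m, m != l.
  by case/card_gt1P: L_gt1 => a [b [_ _]]; have [->|] := eqVneq a l;
     [exists b; rewrite eq_sym | exists a].
rewrite inE; apply/forallPn; exists (rees_elt (j, m)).
rewrite rees_commute Plj orbF xpair_eqE negb_and.
by rewrite eq_sym [l == m]eq_sym neq_ml orbT.
Qed.

Lemma rees_noncommutative : #|I| != 0 -> noncommutative (rees P).
Proof.
case: (pickP I) => [i0 _ _|noI]; last by rewrite (eq_card0 noI).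
have [l0 _] := col_neq0 i0.
have := rees_elt_noncentral (i0, l0); rewrite inE => /forallPn[y /eqP neq].
by exists (rees_elt (i0, l0)), y.
Qed.

Definition rees_vertex (x : I * L) : {x : rees P | x \notin center (rees P)} :=
  Sub (rees_elt x) (rees_elt_noncentral x).

Lemma rees_vertexP u : exists x, u = rees_vertex x.
Proof.
case: u => -[x|] ux; first by exists x; apply: val_inj.
case/negP: (ux); rewrite inE; apply/forallP => y.
by rewrite (rees_is_zero y).1 (rees_is_zero y).2.
Qed.

Lemma commuting_graph_rees i l j m :
  commuting_graph (rees P) (rees_vertex (i, l)) (rees_vertex (j, m)) =
    [&& (i, l) != (j, m), ~~ P l j & ~~ P m i].
Proof.
rewrite /commuting_graph /= rees_commute -(inj_eq val_inj) /=.
rewrite -/(rees_elt _) (inj_eq Some_inj).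
by case: eqP.
Qed.

End Rees.

(** * Bounding the diameter by walks *)

Section WalkLength.

Variables (V : finType) (adj : rel V).

(** A bound, not an exact length: a step of the two bipartite walks may leave the vertex unchanged,
    which is no edge. *)
Definition within (d : nat) (x y : V) : Prop :=
  exists p, [/\ path adj x p, last x p = y & size p <= d].

Lemma within_connect d x y : within d x y -> connect adj x y.
Proof. by case=> p [pp lp _]; apply/connectP; exists p. Qed.

Lemma within_trans d1 d2 x y z :
  within d1 x y -> within d2 y z -> within (d1 + d2) x z.
Proof.
move=> [p [pp <- sp]] [q [pq <- sq]].
by exists (p ++ q); rewrite cat_path pp pq last_cat size_cat leq_add.
Qed.

Lemma has_diameter_within n :
    (forall x y, within n x y) ->
    (exists x y, forall p, path adj x p -> last x p = y -> n <= size p) ->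
  has_diameter adj n.
Proof.
move=> le_n [x [y ge_n]]; split=> [u v||u v d [_ min_d]].
- exact: within_connect (le_n u v).
- exists x, y; split=> //; have [p [pp lp sp]] := le_n x y.
  by exists p; split=> //; apply/eqP; rewrite eqn_leq sp ge_n.
- by have [p [pp lp sp]] := le_n u v; apply: leq_trans (min_d p pp lp) sp.
Qed.

End WalkLength.

(** * The cycle matrix and its diameter *)

Section CycleMatrix.

Variable n : nat.

(* The zero entries form the cycle of length 2(n+1) in which column i sits at
   position 2i and row l at position -(2l+1) modulo 2(n+1). *)
Definition cycle_zero (a b : 'I_n.+1) : bool :=
  (n.+1 %| a + b) || (n.+1 %| (a + b).+1).

Lemma cycle_zeroC a b : cycle_zero a b = cycle_zero b a.
Proof. by rewrite /cycle_zero addnC. Qed.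

Lemma cycle_zeroE a b :
  cycle_zero a b = [|| a + b == 0, a + b == n | a + b == n.+1].
Proof.
have [ltan ltbn] := (ltn_ord a, ltn_ord b).
have small m : m <= n.*2.+1 -> (n.+1 %| m) = (m == 0) || (m == n.+1).
  move=> le_m; apply/dvdnP/orP => [[q def_m]|[]/eqP ->].
  - by apply/orP; case: q def_m => [|[|q]]; nia.
  - by exists 0.
  - by exists 1; rewrite mul1n.
rewrite /cycle_zero !small; lia.
Qed.

Lemma cycle_nonzero a : 1 < n -> exists b, ~~ cycle_zero a b.
Proof.
(* The witness is [1 - a] modulo [n + 1]: its sum with [a] is [1] or [n + 2]. *)
move=> n_gt1; have lt_an := ltn_ord a; pose c := n.+2 - a.
exists (if c < n.+1 then inord c else inord (c - n.+1)).
by rewrite cycle_zeroE; case: ifP => hc; rewrite inordK /c; lia.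
Qed.

Definition cycle_matrix (a b : 'I_n.+1) : bool := ~~ cycle_zero a b.

(** Rows and columns share their index type and [cycle_zero] is symmetric, so the side is left
    implicit; it alternates with [d]. *)
Fixpoint cycle_reach (d : nat) (x y : 'I_n.+1) : Prop :=
  if d is d'.+1 then exists2 z, cycle_reach d' x z & cycle_zero z y else x = y.

(* After d steps one reaches the d+1 consecutive residues e, ..., e + d: the
   neighbours of z are -z and -z - 1. *)
Lemma cycle_reach_interval d (x : 'I_n.+1) :
  exists e, forall t, t <= d -> cycle_reach d x (inord ((e + t) %% n.+1)).
Proof.
elim: d => [|d [e IHd]].
  exists x => t; rewrite leqn0 => /eqP ->.
  by rewrite addn0 modn_small // inord_val.
(* This is [-(e + d) - 1] modulo [n + 1]. For [t > 0] the target is minus its predecessor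
   [e + d + 1 - t]; for [t = 0] it is the other neighbour of [e + d]. *)
exists ((e + d.+1) * n) => t le_t.
exists (inord ((e + (d - t.-1)) %% n.+1)); first by apply: IHd; exact: leq_subr.
have dvdnDmm c u v : (n.+1 %| u %% n.+1 + v %% n.+1 + c) = (n.+1 %| u + v + c).
  by rewrite /dvdn -modnDml modnDm modnDml.
rewrite /cycle_zero !inordK ?ltn_mod // -[(_ + _).+1]addn1 dvdnDmm.
rewrite -[in X in X || _](addn0 (_ %% _ + _)) dvdnDmm addn0.
apply/orP; have [t0|t_gt0] := posnP t.
  by right; apply/dvdnP; exists (e + d.+1); nia.
by left; apply/dvdnP; exists (e + d.+1); nia.
Qed.

Lemma cycle_reach_all x y : cycle_reach n x y.
Proof.
have [e He] := cycle_reach_interval n x.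
(* The offset is [y - e] modulo [n + 1], since [e * n] is [-e]. *)
have -> : y = inord ((e + (y + e * n) %% n.+1) %% n.+1).
  apply/val_inj; rewrite /= inordK ?ltn_mod // modnDmr.
  by rewrite addnCA -mulnS addnC modnMDl modn_small.
by apply: He; rewrite -ltnS ltn_mod.
Qed.

Hypothesis n_gt1 : 1 < n.

Let row_neq0 (l : 'I_n.+1) : exists i, cycle_matrix l i.
Proof. exact: cycle_nonzero. Qed.

Let card_gt1 : 1 < #|'I_n.+1|.
Proof. by rewrite card_ord; exact: ltnW. Qed.

Let vertex := rees_vertex row_neq0 card_gt1.
Let graph := commuting_graph (rees cycle_matrix).

Lemma graph_step x y x' y' :
  cycle_zero x y' -> cycle_zero y x' ->
  within graph 1 (vertex (x, y)) (vertex (x', y')).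
Proof.
move=> xy' yx'; have [<-|neq] := eqVneq (x, y) (x', y'); first by exists [::].
exists [:: vertex (x', y')]; split=> //=.
by rewrite /graph /vertex commuting_graph_rees neq !negbK yx' cycle_zeroC xy'.
Qed.

(** An edge links each old coordinate to the opposite new one, so an odd number of steps exchanges
    the two ends. *)
Lemma graph_walk d x y a b :
    cycle_reach d x a -> cycle_reach d y b ->
  within graph d (vertex (x, y)) (vertex (if odd d then (b, a) else (a, b))).
Proof.
elim: d a b => [|d IHd] a b /=; first by move=> <- <-; exists [::].
move=> [a' xa' a'a] [b' yb' b'b]; rewrite -[d.+1]addn1.
apply: within_trans (IHd _ _ xa' yb') _.
by case: (odd d); apply: graph_step.
Qed.

Lemma graph_within u v : within graph n u v.
Proof.
have [[x y] ->] := rees_vertexP row_neq0 card_gt1 u.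
have [[a b] ->] := rees_vertexP row_neq0 card_gt1 v.
have := graph_walk (cycle_reach_all x (if odd n then b else a))
                   (cycle_reach_all y (if odd n then a else b)).
by case: (odd n).
Qed.

(* Distance in the cycle from column 0 to row x.2 (if rows is true) or to
   column x.1. *)
Definition cycle_dist0 (rows : bool) (x : 'I_n.+1 * 'I_n.+1) : nat :=
  let p := if rows then x.2.*2.+1 else x.1.*2 in minn p (n.+1.*2 - p).

Lemma cycle_dist0_step x y rows :
  graph (vertex x) (vertex y) ->
  cycle_dist0 (~~ rows) y <= (cycle_dist0 rows x).+1.
Proof.
case: x y => [i l] [j m].
rewrite /graph /vertex commuting_graph_rees !negbK !cycle_zeroE.
case/and3P=> _ /= h1 h2; have := (ltn_ord i, ltn_ord l, ltn_ord j, ltn_ord m).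
by rewrite /cycle_dist0; case: rows => /= -[[[? ?] ?] ?]; lia.
Qed.

(** This follows the bipartite walk from the column of [x], which is at a row after an odd number of
    steps. *)
Lemma cycle_dist0_path x y p :
    path graph (vertex x) p -> last (vertex x) p = vertex y ->
  cycle_dist0 (odd (size p)) y <= cycle_dist0 false x + size p.
Proof.
elim/last_ind: p y => [|p v IHp] y /=.
  by rewrite addn0 => _ [->].
rewrite rcons_path last_rcons size_rcons => /andP[pp] + def_v.
have [z def_z] := rees_vertexP row_neq0 card_gt1 (last (vertex x) p).
rewrite def_z def_v => /(cycle_dist0_step (odd (size p))) /leq_trans -> //.
by rewrite addnS ltnS IHp.
Qed.

Lemma graph_diameter : has_diameter graph n.
Proof.
apply: has_diameter_within graph_within _.
(* The parity of the walk is unknown, so both target coordinates must be far from column [0]: their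
   distances are [n] and [n + 1], in an order depending on the parity of [n]. *)
exists (vertex (ord0, ord0)), (vertex (inord n.+1./2, inord n./2)).
move=> p pp lp; apply: leq_trans (cycle_dist0_path pp lp).
rewrite /cycle_dist0 /= !inordK; try lia.
by case: odd; lia.
Qed.

End CycleMatrix.

Theorem corollary9p2 (n : nat) (hn : 2 <= n) :
  exists S : finSemigroupType,
    [/\ noncommutative S,
        completely_zero_simple S
      & has_diameter (commuting_graph S) n].
Proof.
have row_neq0 (l : 'I_n.+1) : exists i, cycle_matrix l i.
  by exact: cycle_nonzero.
have col_neq0 (i : 'I_n.+1) : exists l, cycle_matrix l i.
  by have [l li] := row_neq0 i; exists l; rewrite /cycle_matrix cycle_zeroC.
exists (rees (@cycle_matrix n)); split.
- by apply: rees_noncommutative; rewrite ?card_ord // ltnW.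
- by apply: rees_completely_zero_simple; rewrite ?card_ord.
- exact: graph_diameter.
Qed.
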